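(* The $\sigma$-ideal $f\mathcal{N}(\mathrm{Fin})$ is not $\mathfrak{c}$-cc, where $\mathfrak{c}=2^{\aleph_0}$.
   Context: $\exists^\infty n$ means ''for infinitely many $n\in\omega$''. A subset $F\subseteq\omega^\omega$ belongs to $f\mathcal{N}(\mathrm{Fin})$ if there is a sequence $(S_n)_{n\in\omega}$ of finite sets $S_n\subseteq\omega^n$ such that $F\subseteq\{x\in\omega^\omega:(\exists^\infty n)(x\upharpoonright n\in S_n)\}$; this is a $\sigma$-ideal. A $\sigma$-ideal $\mathcal{I}$ of subsets of $\omega^\omega$ is $\kappa$-cc (for a cardinal $\kappa$) if for every family $\{A_\alpha:\alpha<\kappa\}$ of Borel sets not belonging to $\mathcal{I}$ there are $\alpha\neq\beta$ such that $A_\alpha\cap A_\beta\notin\mathcal{I}$. *)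

(* Defs.v *)
From mathcomp Require Import all_boot all_order all_algebra.
From mathcomp Require Import all_classical all_reals all_analysis.

Set Implicit Arguments.
Unset Strict Implicit.
Unset Printing Implicit Defensive.

Local Open Scope classical_set_scope.

(* The topology of [nat] is the discrete one. *)
Definition baire : topologicalType := prod_topology (fun _ : nat => nat).

Definition restr (x : baire) (n : nat) : n.-tuple nat := [tuple x i | i < n].

Definition fN_Fin : set (set baire) :=
  [set F | exists S : forall n : nat, set (n.-tuple nat),
     (forall n, finite_set (S n)) /\
     F `<=` [set x | infinite_set [set n | S n (restr x n)]] ].

Definition borel (T : topologicalType) : set (set T) := <<s @open T >>.

Definition sigma_ideal (T : Type) (I : set (set T)) : Prop :=
  [/\ I set0,
      (forall A B : set T, A `<=` B -> I B -> I A) &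
      (forall F : nat -> set T, (forall k, I (F k)) -> I (\bigcup_k F k))].

(* The cardinal kappa is represented by an index type [K] of that cardinality;
   the notion is invariant under bijections between index types. *)
Definition kappa_cc (T : topologicalType) (K : Type) (I : set (set T)) : Prop :=
  forall A : K -> set T,
    (forall a, borel (A a)) -> (forall a, ~ I (A a)) ->
    exists a b : K, a <> b /\ ~ I (A a `&` A b).

Lemma fN_Fin_sigma_ideal : sigma_ideal fN_Fin.
Proof.
split.
- by exists (fun _ => set0); split=> // n; exact: finite_set0.
- move=> A B AB [S [fS BS]]; exists S; split=> //.
  exact: subset_trans BS.
- move=> F /choice[S SP].
  exists (fun n => \bigcup_(k in `I_n.+1) S k n); split.
    move=> n; apply: bigcup_finite; first exact: finite_II.
    by move=> k _; have [+ _] := SP k; exact.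
  move=> x [k _ Fkx] /=.
  have [_ /(_ _ Fkx) /= inf] := SP k.
  have := infinite_setD inf (finite_II k); apply: sub_infinite_set.
  by move=> n [Sn /negP]; rewrite -leqNgt => kn; exists k.
Qed.

(* Main.v *)
Require Import Defs.
From mathcomp Require Import all_boot all_order all_algebra.
From mathcomp Require Import all_classical all_reals all_analysis.

Local Open Scope classical_set_scope.

(** There is even a family of continuum many pairwise disjoint closed sets
outside the ideal. The ideal only sees how fast a sequence grows: a sequence
whose [n]-th value exceeds the last entry of every tuple in the finite set
[S n.+1] has no nonempty restriction in any [S n]. Arbitrarily fast growth is
compatible with any prescribed pattern of parities, so the set of sequences
with a given pattern is never in the ideal ([parity_class_notin_fN_Fin]). Such
a set is closed, distinct patterns give disjoint sets, and there are as many
patterns as subsets of [nat]. *)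

Definition parity_class (c : set nat) : set baire :=
  [set x : baire | forall n, odd (x n) = `[< c n >]].

Lemma parity_class_disjoint (c d : set nat) :
  c <> d -> parity_class c `&` parity_class d = set0.
Proof.
move=> cd; apply/seteqP; split=> // x [xc xd]; apply: cd.
apply/seteqP; split=> n.
  by move/asboolP; rewrite -xc xd => /asboolP.
by move/asboolP; rewrite -xd xc => /asboolP.
Qed.

(** Each condition on a single coordinate is the preimage of a subset of the
discrete space [nat] under a continuous projection. *)
Lemma parity_class_closed (c : set nat) : closed (parity_class c).
Proof.
have -> : parity_class c =
    \bigcap_n ((fun x : baire => x n) @^-1` [set k | odd k = `[< c n >]]).
  by apply/seteqP; split=> [x xc n _|x xc n]; [exact: xc | exact: (xc n I)].
apply: closed_bigI => n _; apply: preimage_closed; last exact: discrete_closed.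
by move=> x _; exact: (@proj_continuous _ (fun _ : nat => nat) n).
Qed.

Lemma closed_borel (T : topologicalType) (A : set T) : closed A -> borel A.
Proof.
move=> cA; rewrite -(setCK A) -setTD; apply: sigma_algebraCD.
by apply: sub_sigma_algebra; exact: closed_openC.
Qed.

Lemma finite_tuples_last_bound {n : nat} {S : set (n.+1.-tuple nat)} :
  finite_set S -> exists m, forall t, S t -> tnth t ord_max <= m.
Proof.
move=> /finite_seqP[s ->]; exists (\max_(t <- s) tnth t ord_max).
by move=> t ts; exact: (leq_bigmax_seq (F := fun u => tnth u ord_max) t).
Qed.

(** Diagonalization: an even number above all last entries in [S n.+1], plus
the parity bit, is still above them, so the resulting sequence of the class
can meet [S] only at length [0]. *)
Lemma parity_class_notin_fN_Fin (c : set nat) : ~ fN_Fin (parity_class c).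
Proof.
move=> [S [finS cS]].
have /choice[m mP] n := finite_tuples_last_bound (finS n.+1).
pose x : baire := fun n => `[< c n >] + (m n).+1.*2.
have xc : parity_class c x by move=> n; rewrite /x oddD odd_double addbF oddb.
apply: (cS x xc); apply: sub_finite_set (finite_set1 0) => -[//|n] /= /mP.
rewrite tnth_mktuple /x /= leqNgt => /negP[].
by rewrite (leq_trans _ (leq_addl _ _))// -addnn leq_addr.
Qed.

Theorem theorem13 (K : Type) (cardK : ([set: K] #= [set: set nat])%card) :
  ~ kappa_cc K fN_Fin.
Proof.
have [f finj] : exists f : K -> set nat, {in [set: K] &, injective f}.
  by apply/pcard_injP; move: cardK; rewrite card_eq_le => /andP[].
move=> /(_ (fun a => parity_class (f a))) cc.
have [a|a|a [b [ab]]] := cc.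
- exact: closed_borel (parity_class_closed _).
- exact: parity_class_notin_fN_Fin.
- have [I0 _ _] := fN_Fin_sigma_ideal.
  apply; rewrite parity_class_disjoint => [//|fab]; apply: ab.
  by apply: finj fab; exact: in_setT.
Qed.
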